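(* Let $\mathbf{E}$ and $\mathbf{H}$ be Euclidean spaces, let $f\colon\mathbf{H}\to\overline{\mathbb{R}}$ be a proper, lower-semicontinuous, convex function, and let $\mathcal{A}\colon\mathbf{E}\to\mathbf{H}$ be a linear operator. Then a set $M$ is a face of $f\circ\mathcal{A}$ if and only if $M$ has the form $\mathcal{A}^{-1}(F)$ for some face $F$ of $f$.
   Context: A Euclidean space is a finite-dimensional real inner product space; $\overline{\mathbb{R}}=\mathbb{R}\cup\{\pm\infty\}$; $\mathrm{epi}\,g=\{(x,r):g(x)\le r\}$ and $\mathrm{dom}\,g=\{x:g(x)<\infty\}$. A face of a convex set $Q$ is a convex subset $F\subset Q$ (the empty set being allowed) such that every closed segment in $Q$ whose relative interior meets $F$ lies fully in $F$. A set $F\subset\mathrm{dom}\,g$ is a face of a convex function $g$ if the set $\{(x,g(x)):x\in F\}$ is a face of $\mathrm{epi}\,g$. *)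

(* Defs.v *)
From HB Require Import structures.
From mathcomp Require Import all_boot all_order all_algebra.
From mathcomp Require Import sesquilinear.
From mathcomp Require Import boolp classical_sets interval_inference reals ereal.
From mathcomp Require Import topology normedtype convex.

Set Implicit Arguments.
Unset Strict Implicit.
Unset Printing Implicit Defensive.

Import Order.TTheory GRing.Theory Num.Theory.
Import numFieldNormedType.Exports.

Local Open Scope classical_set_scope.
Local Open Scope ring_scope.
Local Open Scope convex_scope.

(* A finite-dimensional real inner product space, with the norm (hence the
   topology) induced by the inner product. Over a real field, a positive
   definite hermitian form for the identity involution is an inner product. *)
HB.mixin Record isEuclidean (R : realType) V
    & Vector R V & NormedModule R V := {
  inner : {dot V for idfun} ;
  inner_normE : forall x : V, `|x| ^+ 2 = inner x x
}.

#[short(type="euclideanType")]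
HB.structure Definition Euclidean (R : realType) :=
  {V of isEuclidean R V & Vector R V & NormedModule R V}.

Section ConvexFaces.
Context {R : realType} {V : lmodType R}.

Definition segment (x y : convex_lmodType V) : set (convex_lmodType V) :=
  [set x <| t |> y | t in [set: {i01 R}]].

(* Relative interior of [segment x y]; when x = y it is {x}, as it should. *)
Definition segment_relint (x y : convex_lmodType V) : set (convex_lmodType V) :=
  [set x <| t |> y | t in [set t : {i01 R} | 0 < t%:num < 1]].

Definition set_face (Q F : set (convex_lmodType V)) : Prop :=
  [/\ F `<=` Q,
      convex_set F &
      forall x y, segment x y `<=` Q ->
        segment_relint x y `&` F !=set0 -> segment x y `<=` F].

End ConvexFaces.

Section ExtendedRealFunctions.
Context {R : realType} {V : lmodType R}.
Implicit Type g : V -> \bar R.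

Definition edom g : set V := [set x | (g x < +oo)%E].

Definition epi g : set (V * R^o) := [set p | (g p.1 <= p.2%:E)%E].

Definition proper_function g : Prop :=
  edom g !=set0 /\ forall x, (-oo < g x)%E.

Definition convex_efunction g : Prop := convex_set (epi g).

(* The points (x, g x) must lie in V * R, hence the exclusion of the value
   -oo, for which [fine] would return a dummy real number. *)
Definition function_face g (F : set V) : Prop :=
  [/\ F `<=` edom g,
      forall x, F x -> (-oo < g x)%E &
      set_face (epi g) [set (x, fine (g x) : R^o) | x in F]].

End ExtendedRealFunctions.

(* Main.v *)
(* For the linear map B (x, r) = (A x, r), the epigraph of f \o A is the preimage
   under B of the epigraph Q of f, and preimages of faces under linear maps are
   faces. Conversely, let G be the graph of f \o A over a face M, and let U be
   the union of the smallest faces of Q containing the points of B G. It is a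
   face of Q. If B v lies in U, then for some p in G the segment from B p
   towards B v can be prolonged beyond B p inside Q, by a vector which is again
   in the range of B; hence the segment from p towards v can be prolonged beyond
   p inside the preimage of Q, and v is in G. Finally U contains no point
   strictly above the graph of f, so it is the graph of f over the wanted F. *)
Require Import Defs.
From HB Require Import structures.
From mathcomp Require Import all_boot all_order all_algebra.
From mathcomp Require Import boolp classical_sets reals ereal.
From mathcomp Require Import topology normedtype.
From mathcomp Require Import interval_inference convex ring lra.

Set Implicit Arguments.
Unset Strict Implicit.
Unset Printing Implicit Defensive.

Import Order.TTheory GRing.Theory Num.Theory.

Local Open Scope classical_set_scope.
Local Open Scope ring_scope.
Local Open Scope convex_scope.

Section ConvexSets.
Context {R : realType} {V : lmodType R}.
Implicit Types (Q C F : set V) (x y p q : V) (a d e : R).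

Lemma i01_of_real a : 0 <= a <= 1 -> exists t : {i01 R}, t%:num = a.
Proof. by move=> /andP[a0 a1]; exists (Itv01 a0 a1). Qed.

Lemma convex_setP (Q : set (convex_lmodType V)) :
  convex_set Q <->
  forall a x y, 0 <= a <= 1 -> Q x -> Q y -> Q (a *: x + (1 - a) *: y).
Proof.
split=> [Qc a x y /i01_of_real[t <-] Qx Qy|Qc x y t].
  by have /set_mem := Qc x y t (mem_set Qx) (mem_set Qy).
by rewrite !inE => Qx Qy; apply: Qc => //; rewrite ge0 le1.
Qed.

(** One endpoint is enough: exchanging [x] and [y] gives the other, and convexity of [F] then gives
    the whole segment. Convexity of [Q] reduces inclusion of a segment to membership of its ends. *)
Lemma set_faceP (Q F : set (convex_lmodType V)) :
  convex_set Q ->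
  set_face Q F <->
  [/\ F `<=` Q, convex_set F &
      forall a x y, 0 < a < 1 -> Q x -> Q y -> F (a *: x + (1 - a) *: y) ->
        F x].
Proof.
move=> /convex_setP Qc; split=> -[FQ Fc Fext]; split=> //.
  move=> a x y a01 Qx Qy Fxy.
  have [t ta] : exists t : {i01 R}, t%:num = a by apply: i01_of_real; lra.
  apply: (Fext x y).
  - by move=> _ [s _ <-]; apply: Qc => //; rewrite ge0 le1.
  - exists (a *: x + (1 - a) *: y); split=> //.
    by exists t; [rewrite /= ta|rewrite -ta].
  - by exists 1%:i01 => //; rewrite conv1.
move=> x y sQ [_ [[t t01 <-] Fxy]] _ [s _ <-].
have Qx : Q x by apply: sQ; exists 1%:i01 => //; rewrite conv1.
have Qy : Q y by apply: sQ; exists 0%:i01 => //; rewrite conv0.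
move/convex_setP : Fc; apply; first by rewrite ge0 le1.
  exact: Fext t01 Qx Qy Fxy.
apply: (Fext (1 - t%:num) y x) => //; first by move: t01 => /=; lra.
by rewrite subKr addrC.
Qed.

(* The union of the smallest faces of [Q] containing the points of [C]. *)
Definition face_hull Q C : set V :=
  [set q | Q q /\ exists p e, [/\ C p, 0 < e & Q ((1 + e) *: p - e *: q)]].

(** The point prolonged by [d] lies between [p] and the point prolonged by [e], with weight [d / e]
    on the latter. *)
Lemma extension_shrink Q p q d e :
  convex_set (Q : set (convex_lmodType V)) -> Q p -> 0 < d <= e ->
  Q ((1 + e) *: p - e *: q) -> Q ((1 + d) *: p - d *: q).
Proof.
move=> /convex_setP Qc Qp /andP[d0 de] Qe.
have e0 : 0 < e by apply: lt_le_trans de.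
have -> : (1 + d) *: p - d *: q =
    (d / e) *: ((1 + e) *: p - e *: q) + (1 - d / e) *: p.
  rewrite scalerBr !scalerA addrAC -scalerDl.
  by congr (_ *: p - _ *: q); field; rewrite gt_eqF.
by apply: Qc => //; rewrite ler_pdivrMr// mul1r de divr_ge0 ?ltW.
Qed.

Lemma face_hull_sup Q C : C `<=` Q -> C `<=` face_hull Q C.
Proof.
move=> CQ p Cp; split; first exact: CQ.
exists p, 1; split=> //.
by rewrite -scalerBl addrK scale1r; apply: CQ.
Qed.

Lemma face_hull_face (Q C : set (convex_lmodType V)) :
  convex_set Q -> convex_set C -> C `<=` Q -> set_face Q (face_hull Q C).
Proof.
move=> Qcv Ccv CQ; apply/set_faceP => //.
have /convex_setP Qc := Qcv; have /convex_setP Cc := Ccv.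
split; first by move=> q [].
  apply/convex_setP => a q1 q2 a01 [Qq1 [p1 [e1 [Cp1 e10 Q1]]]]
    [Qq2 [p2 [e2 [Cp2 e20 Q2]]]].
  split; first exact: Qc.
  (* With a common prolongation length, the two prolonged points can be mixed with the same weights
     [a] and [1 - a]. *)
  pose e := Num.min e1 e2.
  have e0 : 0 < e by rewrite lt_min e10.
  exists (a *: p1 + (1 - a) *: p2), e; split; [exact: Cc|exact: e0|].
  have -> : (1 + e) *: (a *: p1 + (1 - a) *: p2) -
        e *: (a *: q1 + (1 - a) *: q2) =
      a *: ((1 + e) *: p1 - e *: q1) + (1 - a) *: ((1 + e) *: p2 - e *: q2).
    by rewrite !(scalerBr, scalerDr) !scalerA opprD addrACA
      ![_ * (1 + e)]mulrC ![_ * e]mulrC.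
  apply: Qc => //; [apply: (extension_shrink (e := e1))|
                    apply: (extension_shrink (e := e2))] => //;
    try exact: CQ; by rewrite e0 ge_min lexx ?orbT.
move=> t x y /andP[t0 t1] Qx Qy [_ [p [e [Cp e0 Qz]]]]; split=> //.
(* Mixing the prolonged point with [y], with weights 1 / D and e (1 - t) / D, cancels [y] and leaves
   a point beyond [p] on the line from [x] through [p]. *)
pose D := 1 + e * (1 - t).
have D1 : 1 < D by rewrite ltrDl mulr_gt0 ?subr_gt0.
have D0 : 0 < D by apply: lt_trans D1.
exists p, (e * t / D); split=> //; first by rewrite !(divr_gt0, mulr_gt0).
have -> : (1 + e * t / D) *: p - (e * t / D) *: x =
    D^-1 *: ((1 + e) *: p - e *: (t *: x + (1 - t) *: y)) + (1 - D^-1) *: y.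
  rewrite !(scalerBr, scalerDr) !scalerA opprD !addrA -(scaleNr _ y).
  rewrite -[RHS]addrA -scalerDl (_ : - _ + _ = 0) ?scale0r ?addr0.
    by congr (_ *: p - _ *: x); rewrite /D; field; rewrite gt_eqF.
  by rewrite /D; field; rewrite gt_eqF.
by apply: Qc => //; rewrite invf_le1// invr_ge0 !ltW.
Qed.

End ConvexSets.

Section LinearPreimage.
Context {R : realType} {V W : lmodType R} (B : {linear V -> W}).

Lemma convex_set_preimage (Q : set (convex_lmodType W)) :
  convex_set Q -> convex_set (B @^-1` Q : set (convex_lmodType V)).
Proof.
move=> /convex_setP Qc; apply/convex_setP => a x y a01 Qx Qy.
by rewrite /= linearD !linearZ_LR; apply: Qc.
Qed.

Lemma convex_set_image (G : set (convex_lmodType V)) :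
  convex_set G -> convex_set (B @` G : set (convex_lmodType W)).
Proof.
move=> /convex_setP Gc; apply/convex_setP => a _ _ a01 [x Gx <-] [y Gy <-].
by exists (a *: x + (1 - a) *: y); rewrite ?linearD ?linearZ_LR//; apply: Gc.
Qed.

Lemma set_face_preimage (Q F : set (convex_lmodType W)) :
  convex_set Q -> set_face Q F ->
  set_face (B @^-1` Q : set (convex_lmodType V)) (B @^-1` F).
Proof.
move=> Qc /(set_faceP _ Qc)[FQ Fc Fext].
apply/(set_faceP _ (convex_set_preimage Qc)); split.
- by move=> x /FQ.
- exact: convex_set_preimage.
- move=> a x y a01 Qx Qy; rewrite /= linearD !linearZ_LR.
  exact: (Fext a (B x) (B y)).
Qed.

Lemma preimage_face_hull (Q : set (convex_lmodType W))
    (G : set (convex_lmodType V)) :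
  convex_set Q -> set_face (B @^-1` Q : set (convex_lmodType V)) G ->
  B @^-1` face_hull Q (B @` G) = G.
Proof.
move=> Qc /(set_faceP _ (convex_set_preimage Qc))[GQ Gc Gext].
apply/seteqP; split=> [x [Qx [_ [e [[p Gp <-] e0]]]]|x Gx].
  rewrite -!linearZ_LR -linearB => Qy.
  have e1 : 1 + e != 0 by rewrite gt_eqF// addr_gt0.
  (* [p] lies strictly between [x] and the prolonged point, so extremality of [G] at [p] yields
     [x]. *)
  apply: (Gext (e / (1 + e)) x ((1 + e) *: p - e *: x)) => //.
    by rewrite divr_gt0 ?addr_gt0//= ltr_pdivrMr ?addr_gt0// mul1r ltrDr ltr01.
  have -> : 1 - e / (1 + e) = (1 + e)^-1 by field.
  by rewrite scalerBr !scalerA mulVf// scale1r mulrC addrC subrK.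
apply: face_hull_sup; first by move=> _ [y Gy <-]; apply: GQ.
by exists x.
Qed.

End LinearPreimage.

Definition graph_on {R : realType} {V : lmodType R} (g : V -> \bar R)
    (F : set V) : set (V * R^o) :=
  [set (x, fine (g x) : R^o) | x in F].

Section FunctionFaces.
Context {R : realType} {V : lmodType R} (g : V -> \bar R).
Hypothesis g_gtNy : forall x, (-oo < g x)%E.

Lemma epi_fin_num (p : V * R^o) : epi g p -> g p.1 \is a fin_num.
Proof.
move=> gp; rewrite fin_real// g_gtNy /=.
by apply: le_lt_trans gp _; rewrite ltry.
Qed.

Lemma graph_onP (F : set V) (x : V) :
  graph_on g F (x, fine (g x) : R^o) <-> F x.
Proof. by split=> [[y Fy [<-]]|Fx]; last by exists x. Qed.

(** The side conditions come for free: where [g x] is +oo, [fine] returns 0, but (x, 0) is not in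
    the epigraph. *)
Lemma function_faceP (F : set V) :
  function_face g F <-> set_face (epi g) (graph_on g F).
Proof.
split=> [[]//|gF]; split=> // x Fx.
have [/(_ (x, fine (g x))) gx _ _] := gF.
have /= := epi_fin_num (gx ((graph_onP F x).2 Fx)).
by rewrite fin_numE => /andP[_]; rewrite /edom /= ltey.
Qed.

(* Moving a point of the hull down to the graph moves the point of [C] that
   generates it down as well, while keeping it in the epigraph. *)
Lemma face_hull_epi_graph (C : set (V * R^o)) :
  convex_efunction g ->
  (forall p, C p -> epi g p /\ p.2 = fine (g p.1)) ->
  forall q, face_hull (epi g) C q -> q.2 = fine (g q.1).
Proof.
move=> /convex_setP gc gC [z r] [zr [[u s] [e [Cp e0 Qe]]]] /=.
have [us /= su] := gC _ Cp.
have fz := epi_fin_num zr; have fu := epi_fin_num us.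
have Qz : epi g (z, fine (g z) : R^o) by rewrite /epi /= fineK.
have e1 : 1 + e != 0 by rewrite gt_eqF// addr_gt0.
have a01 : 0 <= (1 + e)^-1 <= 1.
  by rewrite invf_le1 ?addr_gt0// lerDl invr_ge0 (ltW e0) addr_ge0 ?(ltW e0).
(* This mixture lies over [u] at height s - e (r - g z) / (1 + e). Being in the epigraph, it is not
   below g u = s, hence r <= g z. *)
have := gc _ _ _ a01 Qe Qz; rewrite /epi /=.
have -> : (1 + e)^-1 *: ((1 + e) *: u - e *: z) + (1 - (1 + e)^-1) *: z = u.
  rewrite scalerBr !scalerA mulVf// scale1r -addrA -scaleNr -scalerDl.
  by rewrite (_ : - (_ * e) + _ = 0) ?scale0r ?addr0//; field.
move: zr; rewrite /epi /= -{1}(fineK fz) lee_fin => zr.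
rewrite -(fineK fu) lee_fin -su => us'.
apply/eqP; rewrite eq_le zr andbT.
have : (1 + e) * s <= (1 + e) * s - e * r + e * fine (g z).
  have := us'; rewrite -(ler_pM2l (x := 1 + e)) ?addr_gt0//.
  by congr (_ <= _); rewrite /GRing.scale /=; field.
by rewrite -addrA lerDl addrC subr_ge0 ler_pM2l.
Qed.

End FunctionFaces.

Section Composition.
Context {R : realType} {E H : lmodType R} (f : H -> \bar R).
Context (A : {linear E -> H}).

Definition epi_map (p : E * R^o) : H * R^o := (A p.1, p.2).

Fact epi_map_linear : linear epi_map.
Proof. by move=> a p q; rewrite /epi_map /= linearP. Qed.

HB.instance Definition _ :=
  GRing.isLinear.Build R (E * R^o)%type (H * R^o)%type *:%R epi_map
    epi_map_linear.

Lemma graph_on_comp (F : set H) :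
  graph_on (f \o A) (A @^-1` F) = epi_map @^-1` graph_on f F.
Proof.
apply/seteqP; split=> [_ [x Fx <-]|[x r] /= [z Fz [zx <-]]].
  by exists (A x).
by exists x; rewrite /= -?zx.
Qed.

End Composition.

Theorem theorem2p4 (R : realType) (E H : euclideanType R) (f : H -> \bar R)
    (f_proper : proper_function f)
    (f_lsc : lower_semicontinuous f)
    (f_convex : convex_efunction f)
    (A : {linear E -> H}) (M : set E) :
  function_face (f \o A) M <->
  exists F : set H, function_face f F /\ M = A @^-1` F.
Proof.
have [_ f_gtNy] := f_proper.
have fA_gtNy x : (-oo < (f \o A) x)%E by exact: f_gtNy.
rewrite (function_faceP fA_gtNy); split=> [MF|[F [/(function_faceP f_gtNy) FF ->]]].
  pose C := epi_map A @` graph_on (f \o A) M.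
  pose U := face_hull (epi f) C.
  have [MQ Mc _] := MF.
  (* [epi (f \o A)] and the preimage of [epi f] under [epi_map A] are convertible. *)
  have CQ : C `<=` epi f by move=> _ [p Mp <-]; apply: MQ.
  have UF : set_face (epi f) U.
    by apply: face_hull_face => //; apply: convex_set_image.
  have Ugraph q : U q -> q.2 = fine (f q.1).
    apply: face_hull_epi_graph => // p Cp; split; first exact: CQ.
    by case: Cp => _ [x _ <-] <-.
  have preU : epi_map A @^-1` U = graph_on (f \o A) M.
    exact: preimage_face_hull.
  (* Since [U] lies on the graph of [f], this set is its projection to [H], and [U] is the graph
     over it. *)
  exists [set z | U (z, fine (f z) : R^o)]; split.
    apply/function_faceP => //; rewrite (_ : graph_on _ _ = U)//.
    apply/seteqP; split=> [_ [z Uz <-]//|[z r] Uzr].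
    by have /= rE := Ugraph _ Uzr; exists z; rewrite /= -rE.
  apply/seteqP; split=> x; rewrite -(graph_onP (f \o A) M) -preU //.
rewrite graph_on_comp.
exact: (set_face_preimage (epi_map A) f_convex FF).
Qed.
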